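(* There is a family of $2^{\aleph_0}$ nonpathological and pairwise nonisomorphic nontall density-like ideals on $\omega$, none of which is a generalized density ideal.
   Context: $\omega=\{0,1,2,\dots\}$, and each $n\in\omega$ is identified with $\{0,\dots,n-1\}$. An ideal on $\omega$ is a family of subsets of $\omega$ closed under subsets and finite unions; all ideals are assumed to contain every finite subset of $\omega$ and not to contain $\omega$. An ideal $\mathcal{I}$ is tall if every infinite $A\subseteq\omega$ contains an infinite subset belonging to $\mathcal{I}$; nontall means not tall. Ideals $\mathcal{I},\mathcal{J}$ on $\omega$ are isomorphic if there is a bijection $f:\omega\to\omega$ such that, for all $A\subseteq\omega$, $A\in\mathcal{I}$ if and only if $f^{-1}[A]\in\mathcal{J}$. A lower semicontinuous submeasure (lscsm) on $\omega$ is a function $\varphi:\mathcal{P}(\omega)\to[0,\infty]$ that is monotone and subadditive, with $\varphi(\emptyset)=0$, $\varphi(\{n\})<\infty$ for all $n$, and $\varphi(A)=\lim_n\varphi(A\cap n)$ for all $A\subseteq\omega$. Its support is $\mathrm{supp}(\varphi)=\{n\in\omega:\varphi(\{n\})\neq 0\}$. Put $\|A\|_\varphi=\inf\{\varphi(A\setminus F): F\subseteq\omega\text{ finite}\}$ and $\mathrm{Exh}(\varphi)=\{A\subseteq\omega:\|A\|_\varphi=0\}$. A lscsm $\varphi$ is nonpathological if for every $A\subseteq\omega$, $\varphi(A)$ is the supremum of $\eta(A)$ over all finitely additive measures $\eta$ on $\mathcal{P}(\omega)$ with $\eta(V)\le\varphi(V)$ for all $V\subseteq\omega$. An ideal is nonpathological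 if it equals $\mathrm{Exh}(\varphi)$ for some nonpathological lscsm $\varphi$. An ideal $\mathcal{I}$ is a generalized density ideal if $\mathcal{I}=\mathrm{Exh}(\sup_n\mu_n)$ (pointwise supremum) for some sequence $(\mu_n)_{n\in\omega}$ of lscsms with finite pairwise disjoint supports. A lscsm $\varphi$ is density-like if for all $\varepsilon>0$ there is $\delta>0$ such that, whenever $(F_n)_{n\in\omega}$ is a sequence of nonempty finite pairwise disjoint subsets of $\omega$ with $\varphi(F_n)<\delta$ for all $n$, there is an infinite $I\subseteq\omega$ with $\varphi(\bigcup_{i\in I}F_i)<\varepsilon$. An ideal $\mathcal{I}$ is density-like if $\mathcal{I}=\mathrm{Exh}(\varphi)$ for some density-like lscsm $\varphi$. *)

(* Defs.v *)
From mathcomp Require Import all_boot all_order all_algebra.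
From mathcomp Require Import all_classical all_reals all_analysis.

Set Implicit Arguments.
Unset Strict Implicit.
Unset Printing Implicit Defensive.

Import Order.TTheory GRing.Theory Num.Theory.
Import numFieldTopology.Exports.

Local Open Scope classical_set_scope.
Local Open Scope ring_scope.
Local Open Scope ereal_scope.

Record is_ideal (I : set (set nat)) : Prop := IsIdeal {
  ideal_sub : forall A B, A `<=` B -> I B -> I A;
  ideal_setU : forall A B, I A -> I B -> I (A `|` B);
  ideal_finite : forall A, finite_set A -> I A;
  ideal_proper : ~ I setT }.

Definition tall (I : set (set nat)) : Prop :=
  forall A, infinite_set A -> exists B, [/\ B `<=` A, infinite_set B & I B].

Definition isomorphic (I J : set (set nat)) : Prop :=
  exists2 f : nat -> nat, bijective f & forall A, I A <-> J (f @^-1` A).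

Section Submeasures.
Variable R : realType.
Implicit Types (phi : set nat -> \bar R) (I : set (set nat)).

Record lscsm phi : Prop := Lscsm {
  lscsm_ge0 : forall A, 0 <= phi A;
  lscsm_set0 : phi set0 = 0;
  lscsm_le : forall A B, A `<=` B -> phi A <= phi B;
  lscsm_setU : forall A B, phi (A `|` B) <= phi A + phi B;
  lscsm_set1 : forall n, phi [set n] < +oo;
  lscsm_cvg : forall A, phi (A `&` `I_n) @[n --> \oo] --> phi A }.

Definition supp phi : set nat := [set n | phi [set n] != 0].

Definition exh_norm phi (A : set nat) : \bar R :=
  ereal_inf [set phi (A `\` F) | F in [set F | finite_set F]].

Definition Exh phi : set (set nat) := [set A | exh_norm phi A = 0].

(* The canonical measurable structure on nat is discrete, so that a content on
   nat is a finitely additive [0, +oo]-valued measure on all subsets. *)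
Definition nonpathological phi : Prop :=
  forall A, phi A =
    ereal_sup [set eta A | eta in
      [set eta : {content set nat -> \bar R} | forall V, eta V <= phi V]].

Definition density_like phi : Prop :=
  forall eps : R, (0 < eps)%R -> exists2 delta : R, (0 < delta)%R &
    forall F : nat -> set nat,
      (forall n, F n !=set0) -> (forall n, finite_set (F n)) ->
      trivIset setT F -> (forall n, phi (F n) < delta%:E) ->
      exists2 J : set nat, infinite_set J &
        phi (\bigcup_(i in J) F i) < eps%:E.

Definition nonpathological_ideal I : Prop :=
  exists phi, [/\ lscsm phi, nonpathological phi & I = Exh phi].

Definition density_like_ideal I : Prop :=
  exists phi, [/\ lscsm phi, density_like phi & I = Exh phi].

Definition generalized_density_ideal I : Prop :=
  exists mu : nat -> set nat -> \bar R,
    [/\ forall n, lscsm (mu n),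
        forall n, finite_set (supp (mu n)),
        trivIset setT (fun n => supp (mu n)) &
        I = Exh (fun A => ereal_sup (range (fun n => mu n A)))].

End Submeasures.

Arguments nonpathological_ideal R I : clear implicits.
Arguments density_like_ideal R I : clear implicits.
Arguments generalized_density_ideal R I : clear implicits.

(* Main.v *)
Require Import Defs.
From mathcomp Require Import all_boot all_order all_algebra.
From mathcomp Require Import all_classical all_reals all_analysis.
From mathcomp Require Import lra zify.

Set Implicit Arguments.
Unset Strict Implicit.
Unset Printing Implicit Defensive.

Import Order.TTheory GRing.Theory Num.Theory.
Import numFieldTopology.Exports.

Local Open Scope classical_set_scope.

(** Points of [nat] are arranged in rows: the row [(j, i)] consists of the
    naturals with [2]-adic valuation [j] and [3]-adic valuation [i], and the rows
    [(j, i)] with [i < (j + 1)!] form the block [j]. For a nonempty set [Z] of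
    labels, [bphi Z A] is the supremum, over the labels [j] in [Z], of the
    proportion of the rows of the block [j] that [A] meets. The family consists of
    the ideals [Exh (bphi Z)], where [Z] ranges over continuum many sets any two of
    which have infinite differences ([codes]).

    Such an ideal is nonpathological, since the proportion of the rows met by [A]
    is the normalised counting measure of a transversal of these rows inside [A].
    It is not tall, since a set that meets one row of a block of [Z] in infinitely
    many points has positive norm. It is density-like because each block has
    finitely many rows: along an ultrafilter, the sets of rows met by the members
    of a sequence converge, so a thin subsequence meets hardly more rows of a block
    than its members do ([bphi_density_like]).

    It is not a generalized density ideal when [Z] is infinite, because rows are
    infinite: given finite disjoint supports, one can pick a point in every row of
    every block in such a way that no support contains two of the points. Single
    points become negligible, so the set of these points would belong to the ideal,
    although it meets all rows ([bphi_not_generalized_density]).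

    Finally, the ideals for [Z] and [W] are not isomorphic when [Z] has infinitely
    many elements outside [W] ([bphi_not_isomorphic]): the block sizes grow so fast
    that a transversal of the block [j] behaves like no set of points taken from
    blocks with labels other than [j]. Both this and the previous argument rest on
    [Exh_transfer], by which an inclusion between ideals (up to a map) compares the
    values of the two submeasures on disjoint finite sets. *)

(** * Submeasures and their exhaustive ideals *)

Lemma finite_nat_bound (A : set nat) : finite_set A ->
  exists N, forall x, A x -> (x <= N)%N.
Proof.
move=> /finite_seqP[s ->]; exists (\max_(x <- s) x)%N => x /= xs.
exact: (@leq_bigmax_seq _ s xpredT id).
Qed.

Lemma unbounded_infinite (A : set nat) :
  (forall N, exists2 x, (N <= x)%N & A x) -> infinite_set A.
Proof.
move=> hA /finite_nat_bound[N hN]; have [x Nx /hN] := hA N.+1.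
by rewrite leqNgt Nx.
Qed.

Section Submeasures.
Local Open Scope ring_scope.
Local Open Scope ereal_scope.
Variable R : realType.
Implicit Types (phi psi : set nat -> \bar R) (A B F : set nat).

Lemma lscsm_le_fin phi A (c : \bar R) : lscsm phi ->
  (forall n, phi (A `&` `I_n) <= c) -> phi A <= c.
Proof.
move=> hphi hc.
have cvgA := @lscsm_cvg _ _ hphi A.
rewrite -(cvg_lim _ cvgA)//; apply: lime_le; first by apply/cvg_ex; exists (phi A).
exact: nearW.
Qed.

(** A lower semicontinuous submeasure vanishes off its support. *)
Lemma lscsm_le_supp phi A : lscsm phi -> phi A <= phi (A `&` supp phi).
Proof.
move=> hphi; apply: (lscsm_le_fin hphi) => n.
(* Points below [n] are added to [A `&` supp phi] one at a time. *)
apply: (@le_trans _ _ (phi (A `&` supp phi `|` A `&` `I_n))).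
  by apply: (lscsm_le hphi); exact: subsetUr.
elim: n => [|n]; first by rewrite II0 setI0 setU0.
apply: le_trans; set B := (X in _ <= phi X).
have [n0|] := eqVneq (phi [set n]) 0; last first.
  move=> sn; apply: (lscsm_le hphi) => x [[Ax sx]|[Ax]]; first by left.
  rewrite /= ltnS leq_eqVlt => /orP[/eqP xn|xn]; last by right.
  by left; split => //; rewrite xn.
rewrite -[leRHS]adde0 -n0; apply: le_trans (lscsm_setU hphi _ _).
apply: (lscsm_le hphi) => x [[Ax sx]|[Ax]]; first by left; left.
by rewrite /= ltnS leq_eqVlt => /orP[/eqP->|xn]; [right|left; right].
Qed.

Lemma lscsm_bigcup_geo phi (G : nat -> set nat) (e : R) : lscsm phi ->
  (0 < e)%R -> (forall l, phi (G l) <= (e / 2 ^+ l.+1)%:E) ->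
  phi (\bigcup_l G l) <= e%:E.
Proof.
move=> hphi e0 hG; apply: (lscsm_le_fin hphi) => n.
have [M hM] : exists M, (\bigcup_l G l) `&` `I_n `<=` \bigcup_(l in `I_M) G l.
  elim: n => [|n [M hM]]; first by exists 0%N; rewrite II0 setI0.
  have [[l _ Gl]|nG] := pselect ((\bigcup_l G l) n); last first.
    exists M => x [Gx]; rewrite /= ltnS leq_eqVlt => /orP[/eqP xn|xn].
      by case: nG; rewrite -xn.
    exact: hM.
  exists (maxn M l.+1) => x [Gx].
  rewrite /= ltnS leq_eqVlt => /orP[/eqP ->|xn].
    by exists l => //=; rewrite leq_max leqnn orbT.
  have [k kM Gk] := hM x (conj Gx xn); exists k => //=.
  by rewrite leq_max (kM : (k < M)%N).
apply: le_trans (lscsm_le hphi hM) _.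
apply: (@le_trans _ _ (e * (1 - 2 ^- M))%:E); last first.
  by rewrite lee_fin ger_pMr// gerBl invr_ge0 exprn_ge0.
elim: {hM} M => [|M IHM].
  rewrite II0 bigcup_set0 lscsm_set0 // lee_fin expr0 invr1 subrr mulr0 //.
rewrite IIS bigcup_setU bigcup_set1.
apply: le_trans (lscsm_setU hphi _ _) _.
apply: le_trans (leeD IHM (hG M)) _.
rewrite -EFinD lee_fin exprS invfM.
lra.
Qed.

Lemma ExhP phi A : (forall B, 0 <= phi B) ->
  Exh phi A <->
  forall e : R, (0 < e)%R -> exists2 F, finite_set F & phi (A `\` F) < e%:E.
Proof.
move=> phi0; split=> [A0 e e0|hA].
  have : exh_norm phi A < e%:E by rewrite A0 lte_fin.
  by move=> /ereal_inf_lt[_ [F fF <-]] ?; exists F.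
apply/eqP; rewrite eq_le; apply/andP; split; last first.
  by apply: le_ereal_inf_tmp => _ [F _ <-].
apply/lee_addgt0Pr => e /hA[F fF /ltW hF]; rewrite add0e.
by apply: le_trans hF; apply: ereal_inf_lbound; exists F.
Qed.

(** An inclusion between exhaustive ideals is controlled by small finite sets:
    otherwise, some sequence of the sets [F j] has geometrically decreasing
    [phi]-values, whereas the [psi]-values of the preimages stay above [e]; then
    the union of the sequence is in the first ideal, but its preimage is not in
    the second one. *)
Lemma Exh_transfer phi psi (f : nat -> nat) (F : nat -> set nat) (D : set nat)
    (e : R) :
  lscsm phi -> (forall A, 0 <= psi A) ->
  (forall A B, A `<=` B -> psi A <= psi B) ->
  (forall A, Exh phi A -> Exh psi (f @^-1` A)) ->
  (forall j, finite_set (F j)) -> (forall i j x, F i x -> F j x -> i = j) ->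
  (0 < e)%R -> (forall j, D j -> e%:E <= psi (f @^-1` F j)) ->
  exists2 d : R, (0 < d)%R &
    exists N, forall j, D j -> (N <= j)%N -> d%:E <= phi (F j).
Proof.
move=> hphi psi0 psile hexh finF trivF e0 hD; apply: contrapT => hn.
have hP l : exists j, [/\ D j, (l <= j)%N & phi (F j) < (2 ^- l)%:E].
  apply: contrapT => hl; apply: hn; exists (2 ^- l)%R.
    by rewrite invr_gt0 exprn_gt0.
  exists l => j Dj lj; rewrite leNgt; apply/negP => hj.
  by apply: hl; exists j.
have {hP} [p hp] := choice hP.
pose B := \bigcup_l F (p l).
have : Exh phi B.
  apply/(ExhP _ (lscsm_ge0 hphi)) => d d0.
  have [L hL] : exists L, (2 ^- L < d / 2)%R.
    have [L hL] : exists L, (2 / d < L%:R)%R.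
      by exists (Num.bound (2 / d)); rewrite archi_boundP// divr_ge0 ?ltW.
    exists L; rewrite -[ltRHS]invrK ltf_pV2 ?posrE ?exprn_gt0 ?invr_gt0 ?divr_gt0//.
    rewrite invf_div; apply: lt_trans hL _.
    by rewrite -natrX ltr_nat ltn_expl.
  exists (\bigcup_(l in `I_L) F (p l)).
    by apply: bigcup_finite => // l _; exact: finF.
  apply: (@le_lt_trans _ _ (2 * 2 ^- L)%:E); last by rewrite lte_fin; lra.
  apply: (@le_trans _ _ (phi (\bigcup_l F (p (L + l)%N)))).
    apply: (lscsm_le hphi) => x [[l _ Fx] nFx].
    have [lL|Ll] := ltnP l L; first by case: nFx; exists l.
    by exists (l - L)%N => //; rewrite subnKC.
  apply: (lscsm_bigcup_geo hphi) => [|l].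
    by rewrite mulr_gt0// invr_gt0 exprn_gt0.
  have [_ _ /ltW h] := hp (L + l)%N; apply: le_trans h _.
  rewrite lee_fin exprD invfM exprS invfM le_eqVlt; apply/orP; left; apply/eqP.
  by rewrite mulrACA mulfV// mul1r.
move=> /hexh /(ExhP _ psi0) /(_ _ e0)[G finG].
apply/negP; rewrite -leNgt.
have [N hN] : exists N, forall j, (N <= j)%N -> forall x, G x -> ~ F j (f x).
  have hx x : exists j, forall i, (j <= i)%N -> ~ F i (f x).
    have [[i Fi]|nF] := pselect (exists i, F i (f x)); last first.
      by exists 0%N => i _ Fi; apply: nF; exists i.
    by exists i.+1 => k ik Fk; move: ik; rewrite (trivF _ _ _ Fi Fk) ltnn.
  have {hx} [b hb] := choice hx.
  have [N hN] := finite_nat_bound (finite_image b finG).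
  by exists N => j Nj x Gx; apply: hb; apply: leq_trans Nj; apply: hN; exists x.
have [Dp Np _] := hp N.
apply: le_trans (hD _ Dp) _; apply: psile => x Fx; split.
  by exists N.
by move=> Gx; exact: (hN _ Np _ Gx).
Qed.

End Submeasures.

(** * Rows, blocks and the submeasures of the family *)

(** The coordinates of a point: those with label [j] and index [i] form the row
    [(j, i)], which is infinite and contains [corner j i]. The point [0] has
    coordinates [(0, 0)]. *)
Definition lab (x : nat) : nat := logn 2 x.
Definition idx (x : nat) : nat := logn 3 x.
Definition corner (j i : nat) : nat := 2 ^ j * 3 ^ i.

Lemma lab_corner j i : lab (corner j i) = j.
Proof. by rewrite /lab /corner lognM ?expn_gt0// !lognX !logn_prime//= muln1 muln0 addn0. Qed.

Lemma idx_corner j i : idx (corner j i) = i.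
Proof. by rewrite /idx /corner lognM ?expn_gt0// !lognX !logn_prime//= muln1 muln0. Qed.

Lemma corner_gt0 j i : (0 < corner j i)%N.
Proof. by rewrite muln_gt0 !expn_gt0. Qed.

Lemma lab_mul5 x t : (0 < x)%N -> lab (x * 5 ^ t) = lab x.
Proof. by move=> x0; rewrite /lab lognM ?expn_gt0// lognX (@logn_prime _ 5)//= muln0 addn0. Qed.

Lemma idx_mul5 x t : (0 < x)%N -> idx (x * 5 ^ t) = idx x.
Proof. by move=> x0; rewrite /idx lognM ?expn_gt0// lognX (@logn_prime _ 5)//= muln0 addn0. Qed.

Lemma ltn_mul5 x t : (0 < x)%N -> (t < x * 5 ^ t)%N.
Proof. by move=> x0; apply: leq_trans (leq_pmull _ x0); exact: ltn_expl. Qed.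

(** The number of rows of the block [j] that count. The sequence grows faster
    than every geometric one, which tells the blocks apart. *)
Definition bsize (j : nat) : nat := j.+1`!.

Lemma bsize_gt0 j : (0 < bsize j)%N. Proof. exact: fact_gt0. Qed.

Lemma bsize_ge j : (j < bsize j)%N.
Proof. by rewrite /bsize factS leq_pmulr// fact_gt0. Qed.

Lemma bsize_lt i j : (i < j)%N -> (j.+1 * bsize i <= bsize j)%N.
Proof. by move=> ij; rewrite /bsize (factS j) leq_mul2l leq_fact. Qed.

(** The rows of the block [j] met by [A]. *)
Definition hit (j : nat) (A : set nat) : {set 'I_(bsize j)} :=
  [set i : 'I_(bsize j) | `[< exists2 x, A x & lab x = j /\ idx x = i >]]%SET.

Lemma hitP j A (i : 'I_(bsize j)) :
  reflect (exists2 x, A x & lab x = j /\ idx x = i) (i \in hit j A).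
Proof. by rewrite inE; exact: asboolP. Qed.

Lemma hitS j A B : A `<=` B -> hit j A \subset hit j B.
Proof. by move=> AB; apply/fintype.subsetP => i /hitP[x /AB Bx xi]; apply/hitP; exists x. Qed.

Lemma hitU j A B : hit j (A `|` B) = hit j A :|: hit j B.
Proof.
apply/finset.setP => i; rewrite finset.in_setU; apply/hitP/orP => [[x [Ax|Bx] xi]|[]/hitP[x]].
- by left; apply/hitP; exists x.
- by right; apply/hitP; exists x.
- by move=> Ax xi; exists x => //; left.
- by move=> Bx xi; exists x => //; right.
Qed.

Lemma hit_lab_eq0 j A : (forall x, A x -> lab x <> j) -> hit j A = finset.set0.
Proof.
by move=> hA; apply/finset.setP => i; rewrite finset.in_set0; apply/hitP => -[x /hA + [+ _]].
Qed.

Lemma card_hit_le j n A (p : 'I_n -> nat) :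
  (forall x, A x -> exists i, x = p i) -> (#|hit j A| <= n)%N.
Proof.
move=> hA; pose q (i : 'I_n) : 'I_(bsize j) := insubd (Ordinal (bsize_gt0 j)) (idx (p i)).
apply: (@leq_trans #|[set q i | i in 'I_n]%SET|); last first.
  by rewrite -[leqRHS]card_ord; exact: leq_imset_card.
apply/subset_leq_card/fintype.subsetP => k /hitP[x /hA[i ->] [_ ki]].
apply/imsetP; exists i => //; apply: val_inj.
by rewrite /= val_insubd ki ltn_ord.
Qed.

(** A transversal of the rows of a block, inside [A] wherever [A] allows it. *)
Lemma hit_transversal j A : exists p : 'I_(bsize j) -> nat,
  (forall i, lab (p i) = j /\ idx (p i) = i) /\
  (forall i, i \in hit j A -> A (p i)).
Proof.
have h (i : 'I_(bsize j)) : exists x, (lab x = j /\ idx x = i) /\ (i \in hit j A -> A x).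
  have [/hitP[x Ax xi]|_] := boolP (i \in hit j A); first by exists x.
  by exists (corner j i); rewrite lab_corner idx_corner.
have [p hp] := choice h.
by exists p; split=> i; have [] := hp i.
Qed.

Section Phi.
Local Open Scope ring_scope.
Local Open Scope ereal_scope.
Variable R : realType.
Implicit Types (Z A B : set nat).

(** The proportion of the rows of the block [j] that [A] meets. *)
Definition hitfrac (j : nat) (A : set nat) : R := (#|hit j A|%:R / (bsize j)%:R)%R.

(** The submeasure attached to a set [Z] of block labels; blocks with labels
    outside [Z] are ignored. The supremum is meant over a nonempty [Z]. *)
Definition bphi (Z : set nat) (A : set nat) : \bar R :=
  ereal_sup [set (hitfrac j A)%:E | j in Z].

Lemma bsizeR_gt0 j : (0 < (bsize j)%:R :> R)%R.
Proof. by rewrite ltr0n bsize_gt0. Qed.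

Lemma hitfrac_ge0 j A : (0 <= hitfrac j A)%R.
Proof. by rewrite divr_ge0. Qed.

Lemma hitfrac_le j A (n : nat) : (#|hit j A| <= n)%N -> (hitfrac j A <= n%:R / (bsize j)%:R)%R.
Proof. by move=> h; rewrite ler_pM2r ?invr_gt0 ?bsizeR_gt0// ler_nat. Qed.

Lemma hitfracS j A B : A `<=` B -> (hitfrac j A <= hitfrac j B)%R.
Proof. by move=> AB; apply: hitfrac_le; apply: subset_leq_card; exact: hitS. Qed.

Lemma hitfrac_le1 j A : (hitfrac j A <= 1)%R.
Proof.
rewrite ler_pdivrMr ?bsizeR_gt0// mul1r ler_nat -[leqRHS]card_ord.
exact: max_card.
Qed.

Lemma hitfrac_eq0 j A : hit j A = finset.set0 -> hitfrac j A = 0%R.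
Proof. by rewrite /hitfrac => ->; rewrite cards0 mul0r. Qed.

Lemma hitfrac_full j A : hit j A = finset.setT -> hitfrac j A = 1%R.
Proof. by rewrite /hitfrac => ->; rewrite cardsT card_ord divff// lt0r_neq0// bsizeR_gt0. Qed.

Lemma le_bphi Z j A : Z j -> (hitfrac j A)%:E <= bphi Z A.
Proof. by move=> Zj; apply: ereal_sup_ubound; exists j. Qed.

Lemma bphi_le Z A c : (forall j, Z j -> (hitfrac j A)%:E <= c) -> bphi Z A <= c.
Proof. by move=> h; apply: ge_ereal_sup => _ [j Zj <-]; exact: h. Qed.

Lemma bphi_gt Z A c : c < bphi Z A -> exists2 j, Z j & c < (hitfrac j A)%:E.
Proof. by move=> /ereal_sup_gt[_ [j Zj <-] h]; exists j. Qed.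

Lemma bphi_lscsm Z : Z !=set0 -> lscsm (bphi Z).
Proof.
move=> [j0 Zj0].
have bphiS A B : A `<=` B -> bphi Z A <= bphi Z B.
  move=> AB; apply: bphi_le => j Zj; apply: le_trans (le_bphi _ Zj).
  by rewrite lee_fin hitfracS.
have bphi0 A : 0 <= bphi Z A.
  by apply: le_trans (le_bphi _ Zj0); rewrite lee_fin hitfrac_ge0.
split=> //.
- apply/eqP; rewrite eq_le bphi0 andbT; apply: bphi_le => j _.
  by rewrite hitfrac_eq0//; exact: hit_lab_eq0.
- move=> A B; apply: bphi_le => j Zj.
  apply: le_trans (leeD (le_bphi _ Zj) (le_bphi _ Zj)).
  rewrite -EFinD lee_fin /hitfrac -mulrDl ler_pM2r ?invr_gt0 ?bsizeR_gt0//.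
  by rewrite -natrD ler_nat hitU leq_card_setU.
- move=> n; apply: (@le_lt_trans _ _ 1); last exact: ltry.
  by apply: bphi_le => j _; rewrite lee_fin hitfrac_le1.
- move=> A.
  have nd : nondecreasing_seq (fun n => bphi Z (A `&` `I_n)).
    move=> m n mn; apply: bphiS => x [Ax xm]; split => //.
    exact: leq_trans mn.
  suff -> : bphi Z A = ereal_sup (range (fun n => bphi Z (A `&` `I_n))).
    exact: ereal_nondecreasing_cvgn.
  apply/eqP; rewrite eq_le; apply/andP; split; last first.
    by apply: ge_ereal_sup => _ [n _ <-]; apply: bphiS => x [].
  apply: bphi_le => j Zj; have [p [hp Ap]] := hit_transversal j A.
  pose n := \max_(i < bsize j) (p i).+1.
  apply: le_trans (ereal_sup_ubound _); last by exists n.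
  apply: le_trans (le_bphi _ Zj); rewrite lee_fin.
  apply: hitfrac_le; apply: subset_leq_card; apply/fintype.subsetP => i iA.
  apply/hitP; exists (p i) => //; split; first exact: Ap.
  exact: (@leq_bigmax _ (fun i => (p i).+1) i).
Qed.

(** The supremum is attained blockwise by the normalised counting measures of
    the transversals. *)
Lemma bphi_nonpathological Z : Z !=set0 -> nonpathological (bphi Z).
Proof.
move=> Z0; have hphi := bphi_lscsm Z0 => A.
apply/eqP; rewrite eq_le; apply/andP; split; last first.
  by apply: ge_ereal_sup => _ [eta heta <-]; exact: heta.
apply: bphi_le => j Zj; have [p [hp Ap]] := hit_transversal j A.
have c0 : (0 <= (bsize j)%:R^-1 :> R)%R by [].
pose c := NngNum c0.
pose q k : nat := oapp p 0%N (insub k).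
pose eta : {content set nat -> \bar R} :=
  mscale c (msum (fun k => @dirac _ _ (q k) R) (bsize j)).
have etaE V : eta V = (#|[set i | p i \in V]%SET|%:R / (bsize j)%:R)%:E.
  rewrite /eta /= /mscale /= /msum /= mulrC EFinM; congr (_ * _)%E.
  rewrite (eq_bigr (fun i : 'I_(bsize j) => ((p i \in V)%:R)%:E)); last first.
    by move=> i _; rewrite diracE /q valK.
  rewrite sumEFin -natr_sum -sum1_card [in RHS]big_mkcond/=; congr (_%:R%:E).
  by apply: eq_bigr => i _; rewrite finset.inE; case: (p i \in V).
apply: (@le_trans _ _ (eta A)); last first.
  apply: ereal_sup_ubound; exists eta => // V; rewrite etaE; apply: le_trans (le_bphi _ Zj).
  rewrite lee_fin ler_pM2r ?invr_gt0 ?bsizeR_gt0// ler_nat.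
  apply/subset_leq_card/fintype.subsetP => i; rewrite finset.inE => /set_mem Vp.
  by apply/hitP; exists (p i).
rewrite etaE lee_fin ler_pM2r ?invr_gt0 ?bsizeR_gt0// ler_nat.
apply/subset_leq_card/fintype.subsetP => i iA; rewrite finset.inE; apply/mem_set.
exact: Ap.
Qed.

End Phi.

(** * Ideal, density-like and not tall *)

Section Ideals.
Local Open Scope ring_scope.
Local Open Scope ereal_scope.
Variable R : realType.
Implicit Types (Z W A B : set nat).

Lemma bphi_ge0 Z A : Z !=set0 -> 0 <= bphi R Z A.
Proof. by move=> /(bphi_lscsm R) /lscsm_ge0. Qed.

Lemma bphi1_le Z x : bphi R Z [set x] <= ((bsize (lab x))%:R^-1)%:E.
Proof.
apply: bphi_le => j _; rewrite lee_fin.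
have [->|xj] := eqVneq j (lab x).
  rewrite -[leRHS]mul1r; apply: (@hitfrac_le _ _ _ 1).
  by apply: (@card_hit_le _ _ _ (fun=> x)) => y ->; exists ord0.
by rewrite hitfrac_eq0 ?invr_ge0//; apply: hit_lab_eq0 => y -> /esym/eqP; rewrite (negPf xj).
Qed.

(** The first row of the block [j]. *)
Definition row0 (j : nat) : set nat := [set x | lab x = j /\ idx x = 0%N].

Lemma row0_infinite j : infinite_set (row0 j).
Proof.
apply: unbounded_infinite => N; exists (corner j 0 * 5 ^ N)%N.
  by rewrite ltnW// ltn_mul5// corner_gt0.
by rewrite /row0 /= lab_mul5 ?idx_mul5 ?corner_gt0// lab_corner idx_corner.
Qed.

Lemma row0_not_Exh Z j A : Z j -> infinite_set A -> A `<=` row0 j ->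
  ~ Exh (bphi R Z) A.
Proof.
move=> Zj infA Aj /(ExhP _ (fun B => bphi_ge0 B (ex_intro _ j Zj))).
move=> /(_ ((bsize j)%:R^-1)%R); rewrite invr_gt0 bsizeR_gt0 => /(_ isT)[F finF].
apply/negP; rewrite -leNgt; apply: le_trans (le_bphi _ _ Zj).
rewrite lee_fin -[leLHS]mul1r ler_pM2r ?invr_gt0 ?bsizeR_gt0// ler1n.
have /infinite_setN0[x [Ax nFx]] := infinite_setD infA finF.
have [xj xi] := Aj _ Ax.
apply/card_gt0P; exists (Ordinal (bsize_gt0 j)).
by apply/hitP; exists x.
Qed.

Lemma Exh_sub Z A B : Z !=set0 -> A `<=` B -> Exh (bphi R Z) B -> Exh (bphi R Z) A.
Proof.
move=> Z0 AB; have hphi := bphi_lscsm R Z0.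
have ge0 := lscsm_ge0 hphi.
move=> /(ExhP _ ge0) hB; apply/(ExhP _ ge0) => e /hB[F finF hF].
exists F => //; apply: le_lt_trans hF; apply: (lscsm_le hphi).
exact: setSD.
Qed.

Lemma bphi_ideal Z : Z !=set0 -> is_ideal (Exh (bphi R Z)).
Proof.
move=> Z0; have hphi := bphi_lscsm R Z0; have ge0 := lscsm_ge0 hphi.
split.
- by move=> A B; exact: Exh_sub.
- move=> A B /(ExhP _ ge0) hA /(ExhP _ ge0) hB; apply/(ExhP _ ge0) => e e0.
  have e20 : (0 < e / 2)%R by rewrite divr_gt0.
  have [F finF hF] := hA _ e20; have [G finG hG] := hB _ e20.
  exists (F `|` G); first by rewrite finite_setU.
  apply: (@le_lt_trans _ _ (bphi R Z (A `\` F) + bphi R Z (B `\` G))).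
    apply: le_trans (lscsm_setU hphi _ _); apply: (lscsm_le hphi).
    move=> x [[Ax|Bx] nFG]; [left|right]; split=> // h; apply: nFG.
      by left.
    by right.
  by rewrite (splitr e) EFinD lteD.
- move=> A finA; apply/(ExhP _ ge0) => e e0; exists A => //.
  by rewrite setDv lscsm_set0.
- have [j Zj] := Z0 => hT.
  apply: (row0_not_Exh Zj (row0_infinite (j := j)) (@subset_refl _ _)).
  exact: Exh_sub hT.
Qed.

Lemma bphi_not_tall Z : Z !=set0 -> ~ tall (Exh (bphi R Z)).
Proof.
move=> [j Zj] /(_ _ (row0_infinite (j := j)))[B [Bj infB]].
exact: row0_not_Exh Zj infB Bj.
Qed.

(** Along a nonprincipal ultrafilter, the set of rows of the block [j] met by
    [F n] converges to some [C j], and some [F n] meets all rows of [C j]. Thinning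
    out the sequence so that every new member meets only rows of [C j] in each
    block [j] reached before, the union meets in the block [j] at most the rows
    of [C j] and those met by the first member that reaches this block. *)
Lemma bphi_density_like Z : Z !=set0 -> density_like (bphi R Z).
Proof.
move=> Z0 e e0; exists (e / 4)%R; first by rewrite divr_gt0.
move=> F _ finF _ hF.
have [U [UU oU]] := @ultraFilterLemma nat \oo _.
have PU : ProperFilter U := @ultra_proper _ _ UU.
pose C j := [set i : 'I_(bsize j) | `[< U [set n | i \in hit j (F n)]%classic >]]%SET.
have CP j i : reflect (U [set n | i \in hit j (F n)]) (i \in C j).
  by rewrite finset.in_set; exact: asboolP.
have hC j : Z j -> (#|C j|%:R / (bsize j)%:R <= e / 4)%R.
  move=> Zj; have [n hn] : exists n, forall i, i \in C j -> i \in hit j (F n).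
    apply: (@filter_ex _ U); apply: filter_forall => i.
    have [iC|_] := boolP (i \in C j); last exact: filterS filterT.
    by move/CP: iC; exact: filterS.
  rewrite -lee_fin; apply: le_trans (ltW (hF n)).
  apply: le_trans (le_bphi _ _ Zj); rewrite lee_fin.
  rewrite ler_pM2r ?invr_gt0 ?bsizeR_gt0// ler_nat.
  by apply/subset_leq_card/fintype.subsetP.
have /choice[b hb] : forall n, exists b, forall x, F n x -> (lab x <= b)%N.
  move=> n; have [N hN] := finite_nat_bound (finite_image lab (finF n)).
  by exists N => x Fx; apply: hN; exists x.
pose J n := \max_(m < n.+1) b m.
have hJ m n x : (m <= n)%N -> F m x -> (lab x <= J n)%N.
  move=> mn /hb /leq_trans; apply.
  exact: (@leq_bigmax _ (fun m : 'I_n.+1 => b m) (Ordinal (mn : m < n.+1)%N)).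
have JS m n : (m <= n)%N -> (J m <= J n)%N.
  move=> mn; apply/bigmax_leqP => i _.
  have iln : (i < n.+1)%N by rewrite ltnS (leq_trans _ mn)// -ltnS ltn_ord.
  exact: (@leq_bigmax _ (fun m : 'I_n.+1 => b m) (Ordinal iln)).
have /choice[next hnext] : forall n, exists n', (n < n')%N /\
    forall j, (j <= J n)%N -> hit j (F n') \subset C j.
  move=> n.
  have hgt : U [set n' | (n < n')%N] by apply: oU; exact: nbhs_infty_gt.
  have hsub : U [set n' | forall (j : 'I_(J n).+1) (i : 'I_(bsize j)),
      i \in hit j (F n') -> i \in C j].
    apply: filter_forall => j; apply: filter_forall => i.
    have [iC|/CP niC] := boolP (i \in C j); first exact: filterS filterT.
    have [//|] := in_ultra_setVsetC [set n | i \in hit j (F n)] UU.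
    by apply: filterS => n' /= nh /nh.
  have [n' [nn' hn']] := filter_ex (filterI hgt hsub).
  exists n'; split => // j jJ.
  by apply/fintype.subsetP => i; exact: (hn' (Ordinal (jJ : j < (J n).+1)%N)).
pose s k := iter k next 0%N.
have s_ge k : (k <= s k)%N.
  elim: k => // k IHk; apply: leq_ltn_trans IHk _.
  by have [] := hnext (s k).
have s_le k l : (k <= l)%N -> (s k <= s l)%N.
  elim: l => [|l IHl]; first by rewrite leqn0 => /eqP ->.
  rewrite leq_eqVlt => /orP[/eqP ->//|/IHl /leq_trans]; apply.
  by have [/ltnW] := hnext (s l).
exists (range s).
  by apply: unbounded_infinite => N; exists (s N) => //; exists N.
apply: (@le_lt_trans _ _ (e / 2)%:E); last first.
  by rewrite lte_fin ltr_pdivrMr// ltr_pMr// ltr1n.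
apply: bphi_le => j Zj; rewrite lee_fin.
have [hj|nj] := pselect (exists k, (j <= J (s k))%N); last first.
  rewrite hitfrac_eq0 ?divr_ge0 ?ltW//; apply: hit_lab_eq0 => x [_ [k _ <-] Fx] xj.
  by apply: nj; exists k; rewrite -xj (hJ (s k)).
have [k0 jk0 mink0] := ex_minnP hj.
apply: (@le_trans _ _ (#|hit j (F (s k0)) :|: C j|%:R / (bsize j)%:R)%R).
  apply: hitfrac_le; apply/subset_leq_card/fintype.subsetP => i.
  move=> /hitP[x [_ [k _ <-] Fx] xi]; rewrite finset.in_setU; apply/orP.
  have kk : i \in hit j (F (s k)) by apply/hitP; exists x.
  have : (k0 <= k)%N.
    by apply: mink0; have [xj _] := xi; rewrite -xj; exact: (hJ (s k)).
  rewrite leq_eqVlt => /orP[/eqP ->|]; first by left.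
  case: k {Fx} kk => // k kk k0k; right.
  have [_ /(_ j) hk] := hnext (s k).
  have jk : (j <= J (s k))%N by apply: leq_trans jk0 _; apply: JS; exact: s_le.
  exact: (fintype.subsetP (hk jk)).
apply: (@le_trans _ _ (hitfrac R j (F (s k0)) + #|C j|%:R / (bsize j)%:R)%R).
  rewrite /hitfrac -mulrDl ler_pM2r ?invr_gt0 ?bsizeR_gt0// -natrD ler_nat.
  exact: leq_card_setU.
have : (hitfrac R j (F (s k0)) <= e / 4)%R.
  by rewrite -lee_fin; apply: le_trans (le_bphi _ _ Zj) (ltW (hF _)).
have := hC _ Zj; lra.
Qed.

End Ideals.

(** * Not a generalized density ideal *)

Section NotGeneralizedDensity.
Local Open Scope ring_scope.
Local Open Scope ereal_scope.
Variable R : realType.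

Lemma bphi_not_generalized_density (Z : set nat) :
  (forall N, exists2 j, (N <= j)%N & Z j) ->
  ~ generalized_density_ideal R (Exh (bphi R Z)).
Proof.
move=> unbZ [mu [hmu finS trivS IE]].
have Z0 : Z !=set0 by have [j _ Zj] := unbZ 0%N; exists j.
have hphi := bphi_lscsm R Z0; have phi0 := lscsm_ge0 hphi.
set psi := (fun A => _) in IE.
have mu_psi n A : mu n A <= psi A by apply: ereal_sup_ubound; exists n.
have psi0 A : 0 <= psi A by apply: le_trans (lscsm_ge0 (hmu 0%N) A) (mu_psi _ _).
have psiS A B : A `<=` B -> psi A <= psi B.
  move=> AB; apply: ge_ereal_sup => _ [n _ <-].
  exact: le_trans (lscsm_le (hmu n) AB) (mu_psi _ _).
(* [b y] exceeds [y] and every point of the support containing [y]. *)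
have /choice[b hb] : forall y, exists c, (y < c)%N /\
    forall n x, supp (mu n) y -> supp (mu n) x -> (x < c)%N.
  move=> y; have [[n Sy]|nS] := pselect (exists n, supp (mu n) y); last first.
    by exists y.+1; split => // n x Sy; case: nS; exists n.
  have [N hN] := finite_nat_bound (finS n).
  exists N.+1; split; first by rewrite ltnS hN.
  move=> m x Smy Smx; rewrite ltnS; apply: hN.
  by have -> : n = m by apply: trivS => //; exists y.
(* [x k] lies in the row of [k], beyond [b (x l)] for all [l < k]. *)
pose M := nat_rect (fun _ => nat) 0%N (fun k m => maxn m (b (k * 5 ^ m)%N)).
pose x k := (k * 5 ^ M k)%N.
have Mx k : (0 < k)%N -> (M k < x k)%N by exact: ltn_mul5.
have bM l k : (l < k)%N -> (b (x l) <= M k)%N.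
  elim: k => // k IHk; rewrite ltnS leq_eqVlt => /orP[/eqP ->|/IHk h] /=.
    by rewrite leq_max leqnn orbT.
  by rewrite leq_max h.
have bx l k : (l < k)%N -> (b (x l) < x k)%N.
  by move=> lk; apply: leq_ltn_trans (bM _ _ lk) (Mx _ (leq_ltn_trans (leq0n l) lk)).
have x_mono l k : (l < k)%N -> (x l < x k)%N.
  by move=> /bx; apply: leq_trans; have [/ltnW] := hb (x l).
have x_inj l k : x l = x k -> l = k.
  by move=> lk; case: (ltngtP l k) => // /x_mono; rewrite lk ltnn.
have x_supp n l k : supp (mu n) (x l) -> supp (mu n) (x k) -> l = k.
  move=> Sl Sk; case: (ltngtP l k) => // lk.
    have [_ /(_ _ _ Sl Sk) h] := hb (x l).
    by have := ltn_trans h (bx _ _ lk); rewrite ltnn.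
  have [_ /(_ _ _ Sk Sl) h] := hb (x k).
  by have := ltn_trans h (bx _ _ lk); rewrite ltnn.
pose K := [set k | exists j i, (i < bsize j)%N /\ k = corner j i].
pose A := x @` K.
(* Only finitely many points of [A] have a [psi]-value of at least [e / 2]; the
   rest of [A] meets each support in at most one point. *)
have AExh : Exh psi A.
  apply/(ExhP _ psi0) => e e0; have e20 : (0 < e / 2)%R by rewrite divr_gt0.
  pose D := [set k | K k /\ (e / 2)%:E <= psi [set x k]].
  have hexh B : Exh (bphi R Z) B -> Exh psi (id @^-1` B) by rewrite IE.
  have [d d0 [N hN]] := @Exh_transfer _ _ psi id (fun k => [set x k]) D _ hphi psi0
    psiS hexh (fun k => finite_set1 _)
    (fun i j y yi yj => x_inj i j (etrans (esym yi) yj)) e20 (fun k Dk => Dk.2).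
  pose P := Num.bound d^-1.
  have finD : finite_set D.
    apply: (@sub_finite_set _ _ `I_(maxn N (2 ^ P * 3 ^ P)).+1).
      move=> k Dk; rewrite /= ltnS leq_max.
      have [//|Nk] := leqP k N.
      have [[j [i [ij kE]]] _] := Dk.
      have := le_trans (hN _ Dk (ltnW Nk)) (bphi1_le R Z (x k)).
      rewrite lee_fin lab_mul5 ?kE ?corner_gt0// lab_corner.
      rewrite -[d in X in X -> _]invrK lef_pV2 ?posrE ?invr_gt0 ?bsizeR_gt0// => dj.
      have jP : (bsize j < P)%N.
        rewrite -(ltr_nat R); apply: le_lt_trans dj _.
        by rewrite archi_boundP// invr_ge0 ltW.
      rewrite /corner; apply: leq_mul; rewrite leq_exp2l//; last first.
        by rewrite ltnW// (ltn_trans ij).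
      by rewrite ltnW// (ltn_trans (bsize_ge j)).
    exact: finite_II.
  exists (x @` D); first exact: finite_image.
  apply: (@le_lt_trans _ _ (e / 2)%:E); last first.
    by rewrite lte_fin ltr_pdivrMr// ltr_pMr// ltr1n.
  apply: ge_ereal_sup => _ [n _ <-].
  apply: le_trans (lscsm_le_supp _ (hmu n)) _.
  have [[y [[[k Kk xk] nD] Sk]]|] := pselect ((A `\` x @` D) `&` supp (mu n) !=set0).
    have yk : (A `\` x @` D) `&` supp (mu n) `<=` [set x k].
      move=> z [[[l Kl <-] _] Sl] /=; congr x; apply: (x_supp n) => //.
      by rewrite xk.
    apply: le_trans (lscsm_le (hmu n) yk) _; apply: le_trans (mu_psi _ _) _.
    rewrite leNgt; apply/negP => /ltW h; apply: nD; exists k => //.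
  by move=> /nonemptyPn ->; rewrite lscsm_set0// lee_fin ltW.
have : Exh (bphi R Z) A by rewrite IE.
move=> /(ExhP _ phi0) /(_ _ ltr01)[F /finite_nat_bound[N hN]].
have [j Nj Zj] := unbZ N; apply/negP; rewrite -leNgt.
apply: le_trans (le_bphi _ _ Zj); rewrite lee_fin hitfrac_full//.
apply/finset.setP => i; rewrite finset.in_setT; apply/hitP.
exists (x (corner j i)); last first.
  by rewrite lab_mul5 ?idx_mul5 ?corner_gt0// lab_corner idx_corner.
split; first by exists (corner j i) => //; exists j, i.
move=> /hN; apply/negP; rewrite -ltnNge; apply: leq_ltn_trans Nj _.
apply: (@leq_trans (corner j i)); last by rewrite /x leq_pmulr// expn_gt0.
by apply: leq_trans (ltn_expl j (ltnSn 1)) _; rewrite leq_pmulr// expn_gt0.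
Qed.

End NotGeneralizedDensity.

(** * Telling the ideals apart *)

Section NotIsomorphic.
Local Open Scope ring_scope.
Local Open Scope ereal_scope.
Variable R : realType.

Lemma isomorphic_sym (I J : set (set nat)) : isomorphic I J -> isomorphic J I.
Proof.
move=> [f [g fK gK] IJ]; exists g; first by exists f.
move=> A; split => [JA|/IJ].
  by apply/IJ; rewrite -comp_preimage (_ : g \o f = id)//; apply: funext => x /=.
by rewrite -comp_preimage (_ : g \o f = id)//; apply: funext => x /=.
Qed.

(** Let [f] be an isomorphism and [B j] a transversal of the block [j], where
    [j] is in [Z] but not in [W]. As [B j] is large for [Z], its preimage is
    uniformly large for [W], as witnessed by a block [w] in [W] other than [j].
    The block [w] cannot exceed [j], for [B j] has too few points; so it precedes
    [j], and then at most [bsize w] points of [B j] suffice to witness the size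
    of the preimage, although they are negligible for [Z]. *)
Lemma bphi_not_isomorphic (Z W : set nat) : Z !=set0 -> W !=set0 ->
  (forall N, exists2 j, (N <= j)%N & Z j /\ ~ W j) ->
  ~ isomorphic (Exh (bphi R Z)) (Exh (bphi R W)).
Proof.
move=> Z0 W0 unbD iso.
have hZ := bphi_lscsm R Z0; have hW := bphi_lscsm R W0.
have [f [g fK gK] ZW] := iso.
have WZ A : Exh (bphi R W) A -> Exh (bphi R Z) (g @^-1` A).
  move=> WA; apply/ZW; rewrite -comp_preimage (_ : g \o f = id)//.
  by apply: funext => x /=.
pose D := [set j | Z j /\ ~ W j].
pose B j := [set y | exists i : 'I_(bsize j), y = corner j i].
have labB j y : B j y -> lab y = j by move=> [i ->]; exact: lab_corner.
have finB j : finite_set (B j).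
  apply: (@sub_finite_set _ _ [set corner j i | i in [set: 'I_(bsize j)]]).
    by move=> _ [i ->]; exists i.
  exact: finite_image.
have fin_preim A : finite_set A -> finite_set (f @^-1` A).
  move=> finA; apply: (@sub_finite_set _ _ (g @` A)); last exact: finite_image.
  by move=> y Ay; exists (f y).
have [d d0 [N1 hN1]] : exists2 d : R, (0 < d)%R & exists N, forall j, D j -> (N <= j)%N ->
    d%:E <= bphi R W (f @^-1` B j).
  apply: (@Exh_transfer _ _ (bphi R Z) g (fun j => f @^-1` B j) D 1%R) => //.
  - by move=> A; exact: lscsm_ge0.
  - by move=> A A'; exact: lscsm_le.
  - by move=> j; exact: fin_preim.
  - by move=> i j y /labB <- /labB.
  - move=> j [Zj _]; rewrite -comp_preimage (_ : f \o g = id); last exact/funext.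
    apply: le_trans (le_bphi _ _ Zj); rewrite lee_fin hitfrac_full//.
    apply/finset.setP => i; rewrite finset.in_setT; apply/hitP.
    exists (corner j i); last by rewrite lab_corner idx_corner.
    by exists i.
have d20 : (0 < d / 2)%R by rewrite divr_gt0.
have d2d : (d / 2 < d)%R by rewrite ltr_pdivrMr// ltr_pMr// ltr1n.
have [P hP] : exists P, forall j, (P <= j)%N -> (j.+1%:R^-1 < d / 2)%R.
  exists (Num.bound (d / 2)^-1) => j Pj.
  rewrite invf_plt ?posrE//; apply: lt_le_trans (archi_boundP _) _.
    by rewrite invr_ge0 ltW.
  by rewrite ler_nat ltnW.
have ratio i j : (i < j)%N -> ((bsize i)%:R / (bsize j)%:R <= j.+1%:R^-1 :> R)%R.
  move=> /bsize_lt ij; rewrite ler_pdivrMr ?bsizeR_gt0//.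
  by rewrite mulrC ler_pdivlMr// -natrM ler_nat mulnC.
pose D' := [set j | D j /\ (maxn N1 P <= j)%N].
have /choice[E hE] : forall j, exists E, D' j ->
    [/\ E `<=` B j, bphi R Z E <= (j.+1%:R^-1)%:E &
        (d / 2)%:E <= bphi R W (f @^-1` E)].
  move=> j; have [[Dj]|] := pselect (D' j); last by exists set0.
  rewrite geq_max => /andP[N1j Pj].
  have : (d / 2)%:E < bphi R W (f @^-1` B j).
    by apply: lt_le_trans (hN1 _ Dj N1j); rewrite lte_fin.
  move=> /bphi_gt[w Ww]; rewrite lte_fin => hw.
  have wj : (w < j)%N.
    case: (ltngtP w j) => // [jw|wj]; last by case: Dj => _; rewrite -wj.
    have : (d / 2 < w.+1%:R^-1)%R.
      apply: lt_le_trans hw _; apply: le_trans (ratio _ _ jw); apply: hitfrac_le.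
      apply: (@card_hit_le _ _ _ (fun i : 'I_(bsize j) => g (corner j i))).
      by move=> y [i fy]; exists i; rewrite -fy fK.
    by rewrite ltNge ltW// hP// (leq_trans Pj (ltnW jw)).
  have [p [hp Bp]] := hit_transversal w (f @^-1` B j).
  exists [set f (p i) | i in [set i | i \in hit w (f @^-1` B j)]] => _; split.
  - by move=> _ [i /Bp fB <-].
  - apply: bphi_le => k _; rewrite lee_fin.
    have [->|kj] := eqVneq k j; last first.
      rewrite hitfrac_eq0 ?invr_ge0//; apply: hit_lab_eq0 => _ [i /Bp/labB lj <-].
      by rewrite lj => /esym; exact/eqP.
    apply: le_trans (ratio _ _ wj); apply: hitfrac_le.
    apply: (@card_hit_le _ _ _ (fun i : 'I_(bsize w) => f (p i))).
    by move=> _ [i _ <-]; exists i.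
  - apply: le_trans (le_bphi _ _ Ww); rewrite lee_fin; apply: le_trans (ltW hw) _.
    apply: hitfrac_le; apply/subset_leq_card/fintype.subsetP => i hi.
    by apply/hitP; exists (p i) => //; exists i.
pose E' j := E j `&` B j.
have [d' d'0 [N2 hN2]] : exists2 d' : R, (0 < d')%R & exists N, forall j, D' j -> (N <= j)%N ->
    d'%:E <= bphi R Z (E' j).
  apply: (@Exh_transfer _ _ (bphi R W) f E' D' (d / 2)%R) => //.
  - by move=> A; exact: lscsm_ge0.
  - by move=> A A'; exact: lscsm_le.
  - by move=> A /ZW.
  - by move=> j; apply: sub_finite_set (finB j) => y [].
  - by move=> i j y [_ /labB <-] [_ /labB].
  - by move=> j /hE[EB _]; rewrite /E' setIidl.
have [j hj Dj] := unbD (maxn (maxn N1 P) (maxn N2 (Num.bound d'^-1))).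
move: hj; rewrite geq_max => /andP[NPj]; rewrite geq_max => /andP[N2j bj].
have D'j : D' j by split.
have [_ Ej _] := hE _ D'j.
have := le_trans (hN2 _ D'j N2j) (le_trans (lscsm_le hZ (@subIsetl _ _ _)) Ej).
rewrite lee_fin leNgt => /negP; apply.
rewrite invf_plt ?posrE//; apply: lt_le_trans (archi_boundP _) _.
  by rewrite invr_ge0 ltW.
by rewrite ler_nat ltnW.
Qed.

End NotIsomorphic.

(** * The family *)

(** The number whose binary expansion is a leading [1] followed by the first [n]
    values of the indicator function of [X]. *)
Fixpoint code (X : set nat) (n : nat) : nat :=
  if n is m.+1 then (`[< X m >] + (code X m).*2)%N else 1%N.

Lemma code_gt0 X n : (0 < code X n)%N.
Proof. by elim: n => //= n IHn; rewrite addn_gt0 double_gt0 IHn orbT. Qed.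

Lemma code_ge X n : (n < code X n)%N.
Proof.
elim: n => //= n IHn; apply: leq_trans (leq_addl _ _).
by rewrite -addnn -addn1 leq_add// code_gt0.
Qed.

Lemma code_inj X Y n m : code X n = code Y m ->
  n = m /\ forall i, (i < n)%N -> X i <-> Y i.
Proof.
elim: n m => [|n IHn] [|m] /=.
- by [].
- by move=> h; have := code_gt0 Y m; lia.
- by move=> h; have := code_gt0 X n; lia.
- move=> h; have hb : `[< X n >] = `[< Y m >].
    by move/(congr1 odd): h; rewrite !oddD !odd_double !addbF !oddb.
  have [|nm hi] := IHn m.
    by move: h; rewrite hb => /addnI/double_inj.
  rewrite -nm in hb *; split=> // i; rewrite ltnS leq_eqVlt => /orP[/eqP ->|/hi//].
  by split=> /asboolP; [rewrite hb|rewrite -hb] => /asboolP.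
Qed.

Definition codes (X : set nat) : set nat := range (code X).

Lemma codes_unbounded X N : exists2 j, (N <= j)%N & codes X j.
Proof. by exists (code X N); [rewrite ltnW// code_ge|exists N]. Qed.

Lemma codesD_unbounded X Y N : X <> Y ->
  exists2 j, (N <= j)%N & codes X j /\ ~ codes Y j.
Proof.
move=> XY; have [i Xi] : exists i, ~ (X i <-> Y i).
  apply: contrapT => h; apply: XY; apply: funext => i; apply: propext.
  by apply: contrapT => nXY; apply: h; exists i.
exists (code X (N + i.+1)).
  by rewrite ltnW// (leq_ltn_trans (leq_addr i.+1 N))// code_ge.
split; first by exists (N + i.+1)%N.
move=> [m _ /esym/code_inj[_ /(_ i)]].
by rewrite addnS ltnS leq_addl => /(_ isT).
Qed.

Theorem theorem3p7 (R : realType) :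
  exists Fam : set (set (set nat)),
    [/\ (Fam #= [set: set nat])%card,
        forall I, Fam I ->
          [/\ is_ideal I, nonpathological_ideal R I, density_like_ideal R I,
              ~ tall I & ~ generalized_density_ideal R I] &
        forall I J, Fam I -> Fam J -> I <> J -> ~ isomorphic I J].
Proof.
pose I X := Exh (bphi R (codes X)).
have codes0 X : codes X !=set0 by exists (code X 0), 0%N.
have noniso X Y : X <> Y -> ~ isomorphic (I X) (I Y).
  move=> XY; apply: bphi_not_isomorphic => // N.
  exact: codesD_unbounded.
exists (range I); split.
- apply: inj_card_eq => X Y _ _ IXY; apply: contrapT => /noniso; apply.
  by rewrite IXY; exists id => //; exists id.
- move=> _ [X _ <-]; split.
  + exact: bphi_ideal.
  + exists (bphi R (codes X)); split => //; first exact: bphi_lscsm.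
    exact: bphi_nonpathological.
  + exists (bphi R (codes X)); split => //; first exact: bphi_lscsm.
    exact: bphi_density_like.
  + exact: bphi_not_tall.
  + by apply: bphi_not_generalized_density => N; exact: codes_unbounded.
- move=> _ _ [X _ <-] [Y _ <-] IXY; apply: noniso => XY.
  by apply: IXY; rewrite XY.
Qed.
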